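(* Let $Y=[y_L,y_U]$ be a random interval with measurable endpoints satisfying $y_L\le y_U$ almost surely and $y_L,y_U\in L^1(\mathbf{P})$. Then for any $\kappa\in[\mathbf{E}(y_L),\mathbf{E}(y_U)]$, $$\mathbf{Sel}(Y\mid\kappa)\neq\emptyset .$$
   Context: $(\Omega,\mathcal A,\mathbf P)$ is a complete non-atomic probability space, $\mathbf E$ denotes expectation. A random interval is $Y(\omega)=[y_L(\omega),y_U(\omega)]\subset\mathbb R$ with $y_L,y_U:\Omega\to\mathbb R$ measurable and $\mathbf P(y_L\le y_U)=1$. $\mathbf{Sel}(Y)$ is the set of measurable $y:\Omega\to\mathbb R$ with $y(\omega)\in Y(\omega)$ for $\mathbf P$-a.e. $\omega$. For $\kappa\in\mathbb R$, the $\kappa$-mean restricted selection set is $\mathbf{Sel}(Y\mid\kappa):=\{y\in\mathbf{Sel}(Y):\mathbf E[y]=\kappa\}$. *)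

(* Defs.v *)
From HB Require Import structures.
From mathcomp Require Import all_boot all_order all_algebra.
From mathcomp Require Import all_classical all_reals all_analysis.

Set Implicit Arguments.
Unset Strict Implicit.
Unset Printing Implicit Defensive.

Import Order.TTheory GRing.Theory Num.Theory.

Local Open Scope classical_set_scope.
Local Open Scope ring_scope.
Local Open Scope ereal_scope.

Definition nonatomic (d : measure_display) (T : measurableType d)
    (R : realType) (P : probability T R) : Prop :=
  forall A : set T, measurable A -> 0 < P A ->
    exists B : set T, [/\ measurable B, B `<=` A & 0 < P B < P A].

Definition random_interval (T : Type) (R : realType) (yL yU : T -> R) :
    T -> set R :=
  fun w => [set` `[yL w, yU w]].

Definition Sel (d : measure_display) (T : measurableType d) (R : realType)
    (P : probability T R) (Y : T -> set R) : set (T -> R) :=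
  [set y | measurable_fun [set: T] y /\ {ae P, forall w, Y w (y w)}].

(* Integrability is what makes E[y] a well-defined real number. *)
Definition Sel_mean (d : measure_display) (T : measurableType d)
    (R : realType) (P : probability T R) (Y : T -> set R) (kappa : R) :
    set (T -> R) :=
  [set y | [/\ Sel P Y y, y \in Lfun P 1 & 'E_P[y] = kappa%:E]].

(* Main.v *)
Require Import Defs.
From HB Require Import structures.
From mathcomp Require Import all_boot all_order all_algebra.
From mathcomp Require Import all_classical all_reals all_analysis.
From mathcomp Require Import ring lra.

(** The endpoints are themselves integrable selections, and being an integrable
    selection is preserved by convex combinations with a constant weight [t],
    because the values of the random interval are intervals. The expectation is
    affine, so along [(1 - t) yL + t yU] it sweeps everything between the
    expectations of [yL] and [yU]; [convex_weight_exists] gives the [t] at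
    which it equals [kappa]. *)

Set Implicit Arguments.
Unset Strict Implicit.
Unset Printing Implicit Defensive.

Import Order.TTheory GRing.Theory Num.Theory.

Local Open Scope classical_set_scope.
Local Open Scope ring_scope.
Local Open Scope ereal_scope.

Lemma convex_weight_exists (F : realFieldType) (a k b : F) :
  (a <= k <= b)%R ->
  exists t : F, (0 <= t <= 1 /\ (1 - t) * a + t * b = k)%R.
Proof.
move=> /andP[ak kb]; have [ab|ba] := ltP a b; last first.
  (* the interval is a single point and every weight gives [k] *)
  by exists 0%R; split; lra.
have ba_gt0 : (0 < b - a)%R by rewrite subr_gt0.
exists ((k - a) / (b - a))%R; split; last by field; rewrite gt_eqF.
by rewrite divr_ge0 ?ler_pdivrMr ?mul1r ?lerB// subr_ge0// ltW.
Qed.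

Lemma ae_probability1 (d : measure_display) (T : measurableType d)
    (R : realType) (P : probability T R) (A : set T) :
  measurable A -> P A = 1 -> {ae P, forall w, A w}.
Proof.
move=> mA PA1; exists (~` A); split=> //; first exact: measurableC.
by rewrite probability_setC// PA1 subee.
Qed.

Lemma expectation_convex (d : measure_display) (T : measurableType d)
    (R : realType) (P : probability T R) (X Y : T -> R) (t : R) :
  X \in Lfun P 1 -> Y \in Lfun P 1 ->
  'E_P[((1 - t) \o* X \+ t \o* Y)%R] =
    (1 - t)%:E * 'E_P[X] + t%:E * 'E_P[Y].
Proof.
by move=> X1 Y1; rewrite expectationD ?expectationZl//; exact: Lfun_scale.
Qed.

Theorem proposition2p2 (R : realType) (d : measure_display)
    (T : measurableType d) (P : probability T R)
    (P_complete : measure_is_complete P) (P_nonatomic : nonatomic P)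
    (yL yU : {RV P >-> R})
    (yL_le_yU : P [set w | (yL w <= yU w)%R] = 1)
    (yL_L1 : (yL : T -> R) \in Lfun P 1)
    (yU_L1 : (yU : T -> R) \in Lfun P 1)
    (kappa : R) (kappa_in : 'E_P[yL] <= kappa%:E <= 'E_P[yU]) :
  Sel_mean P (random_interval yL yU) kappa !=set0.
Proof.
have mA : measurable [set w | (yL w <= yU w)%R].
  by rewrite -[X in measurable X]setTI; exact: measurable_fun_le.
have EL := fineK (expectation_fin_num yL_L1).
have EU := fineK (expectation_fin_num yU_L1).
move: kappa_in; rewrite -EL -EU !lee_fin => /convex_weight_exists.
move=> [t [/andP[t0 t1] tE]].
exists ((1 - t) \o* yL \+ t \o* yU)%R.
have y_L1 : ((1 - t) \o* yL \+ t \o* yU)%R \in Lfun P 1.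
  by rewrite rpredD ?Lfun_scale.
split=> //; last first.
  by rewrite expectation_convex// -EL -EU -!EFinM -EFinD tE.
split; first by have := sub_Lfun_mfun y_L1; rewrite inE.
apply: filterS (ae_probability1 mA yL_le_yU) => w /= LU.
by rewrite /random_interval/= in_itv/=; apply/andP; split; nra.
Qed.
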